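(* Let $Q$ be a quiver constructed from a triangulation of an unpunctured surface. Then there exists an admissible quasi-Cartan companion $A$ of $Q$ such that for any (finite) mutation sequence $\mu$ the matrix $\mu(A)$ is an admissible quasi-Cartan companion of $\mu(Q)$. In particular, $A$ is a symmetric twin of $Q$.
   Context: A quiver $Q$ with vertices $1,\dots,n$ is identified with an integer skew-symmetric $n\times n$ matrix $B=(b_{ij})$: if $b_{ij}>0$ there are $b_{ij}$ arrows from $i$ to $j$. The mutation $\mu_k(Q)$ is the quiver of $B'=(b'_{ij})$ with $b'_{ij}=-b_{ij}$ if $i=k$ or $j=k$, and $b'_{ij}=b_{ij}+\frac12(|b_{ik}|b_{kj}+b_{ik}|b_{kj}|)$ otherwise. An unpunctured surface is a compact connected oriented surface with at least one boundary component and a finite set of marked points, all on the boundary, with at least one marked point on every boundary component; it is assumed to admit a triangulation with at least one interior arc. A triangulation is a maximal collection of pairwise non-crossing, pairwise non-isotopic simple arcs with endpoints at marked points (not contractible and not isotopic to boundary segments); it cuts the surface into triangles. Its quiver has the arcs (interior edges) as vertices; each triangle contributes one arrow between every two of its sides that are arcs, the arrows inside a triangle being directed counter-clockwise; pairs of opposite arrows cancel. A quasi-Cartan companion of $Q$ is a symmetric $n\times n$ matrix $A=(a_{ij})$ with $a_{ii}=2$ and $|a_{ij}|=|b_{ij}|$ for $i\ne j$. It is admissible if for every chordless cycle $i_1,\dots,i_m$ ($m\ge3$) of $Q$ the product $\prod_{j}(-a_{i_j i_{j+1}})$ (indices mod $m$) is negative if the cycle is oriented and positive otherwise. Mutation of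 companions: $\mu_k(A)=(a'_{ij})$ with $a'_{ii}=2$; $a'_{ik}=a'_{ki}=\mathrm{sgn}(b_{ik})a_{ik}$ for $i\ne k$; and $a'_{ij}=a_{ij}-\mathrm{sgn}(a_{ik}a_{kj})[b_{ik}b_{kj}]_+$ for distinct $i,j\neq k$, where $[x]_+=\max(x,0)$. For a mutation sequence, $Q$ and $A$ are mutated simultaneously step by step. A quasi-Cartan companion $A$ of $Q$ is a symmetric twin of $Q$ if for every mutation sequence $\mu$ the matrix $\mu(A)$ is a quasi-Cartan companion of $\mu(Q)$. *)

(* Defs.v *)
From HB Require Import structures.
From mathcomp Require Import all_boot all_order all_algebra.

Set Implicit Arguments.
Unset Strict Implicit.
Unset Printing Implicit Defensive.

Import Order.TTheory GRing.Theory Num.Theory.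
Local Open Scope ring_scope.

(** Triangulated unpunctured surfaces.

    A compact oriented surface with a triangulation T is recorded by cutting
    it along the arcs of T: what remains is a finite set of triangles,
    indexed by ['I_m], each with its three sides in counter-clockwise order,
    [(t, i)] with [i : 'I_3].  The arcs of T are numbered by ['I_n]; [side]
    gives the arc on which a side lies, or [None] for a boundary segment.
    The surface is recovered by gluing the two sides carrying the same arc
    along the identification that reverses their counter-clockwise
    directions (the only one compatible with the orientation). *)

Definition tside (m : nat) := ('I_m * 'I_3)%type.

Definition ccw (m : nat) (d : tside m) : tside m := (d.1, ordS d.2).

Definition glued (m n : nat) (side : tside m -> option 'I_n) : rel (tside m) :=
  fun d e => [&& d != e, side d != None & side d == side e].

Definition adjacent_triangles (m n : nat) (side : tside m -> option 'I_n) :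
    rel 'I_m :=
  fun t u => [exists i : 'I_3, exists j : 'I_3, glued side (t, i) (u, j)].

(** The side [d] also stands for the corner of its triangle at the initial
    point of [d].  Crossing the arc that carries [d] (to the side [d'] glued
    to [d], whose final point is the initial point of [d]), one reaches the
    next corner at the same marked point, namely that of [ccw d']. *)
Definition next_corner (m n : nat) (side : tside m -> option 'I_n) :
    rel (tside m) :=
  fun d e => [exists d', glued side d d' && (e == ccw d')].

(** The corners at a marked point of the boundary form a linear fan, so that
    turning around the point one ends on a boundary segment; the corners at
    an interior marked point (a puncture) form a closed cycle.  Hence
    [unpunctured] says that all marked points lie on the boundary.  It forces
    the boundary to be nonempty and rules out self-folded triangles; as every
    boundary component is a union of sides, it carries marked points. *)
Definition unpunctured (m n : nat) (side : tside m -> option 'I_n) : Prop :=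
  forall d, exists2 e, connect (next_corner side) d e & side e = None.

Record triangulation (n : nat) := Triangulation {
  ntriangles : nat;
  side : tside ntriangles -> option 'I_n;
  arc_two_sides : forall k : 'I_n, #|[set d | side d == Some k]| = 2%N;
  surface_connected : forall t u, connect (adjacent_triangles side) t u;
  all_marked_points_on_boundary : unpunctured side;
  has_interior_arc : (0 < n)%N
}.

Arguments side {n} T d : rename.

Definition arrows (n : nat) (T : triangulation n) (i j : 'I_n) : nat :=
  #|[set d | (side T d == Some i) && (side T (ccw d) == Some j)]|.

(** Quivers are identified with their skew-symmetric integer matrices; taking
    the difference cancels pairs of opposite arrows. *)
Definition quiver_of (n : nat) (T : triangulation n) : 'M[int]_n :=
  \matrix_(i, j) ((arrows T i j)%:Z - (arrows T j i)%:Z).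

(** The division by 2 is exact: the sum is 0 or twice a product. *)
Definition quiver_mutation (n : nat) (k : 'I_n) (B : 'M[int]_n) : 'M[int]_n :=
  \matrix_(i, j)
    if (i == k) || (j == k) then - B i j
    else B i j + ((`|B i k| * B k j + B i k * `|B k j|) %/ 2)%Z.

Definition quasi_Cartan_companion (n : nat) (B A : 'M[int]_n) : Prop :=
  [/\ A^T = A,
      forall i, A i i = 2
    & forall i j, i != j -> `|A i j| = `|B i j|].

(** A cycle is the list of its vertices in cyclic order, [next s x] being the
    successor of [x]; chordless means that the full subquiver on [s] has no
    edge besides those of the cycle. *)
Definition chordless_cycle (n : nat) (B : 'M[int]_n) (s : seq 'I_n) : Prop :=
  [/\ (3 <= size s)%N, uniq s
    & {in s &, forall x y,
        (B x y != 0) = (next s x == y) || (next s y == x)}].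

Definition oriented_cycle (n : nat) (B : 'M[int]_n) (s : seq 'I_n) : bool :=
  all (fun x => 0 < B x (next s x)) s || all (fun x => B x (next s x) < 0) s.

Definition admissible (n : nat) (B A : 'M[int]_n) : Prop :=
  forall s, chordless_cycle B s ->
    if oriented_cycle B s then \prod_(x <- s) - A x (next s x) < 0
    else 0 < \prod_(x <- s) - A x (next s x).

Definition admissible_companion (n : nat) (B A : 'M[int]_n) : Prop :=
  quasi_Cartan_companion B A /\ admissible B A.

Definition companion_mutation (n : nat) (k : 'I_n) (B A : 'M[int]_n) :
    'M[int]_n :=
  \matrix_(i, j)
    if i == j then 2
    else if j == k then Num.sg (B i k) * A i k
    else if i == k then Num.sg (B j k) * A j k
    else A i j - Num.sg (A i k * A k j) * Num.max (B i k * B k j) 0.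

Definition pair_mutation (n : nat) (BA : 'M[int]_n * 'M[int]_n) (k : 'I_n) :
    'M[int]_n * 'M[int]_n :=
  (quiver_mutation k BA.1, companion_mutation k BA.1 BA.2).

(** The mutations of [mu] are performed from left to right. *)
Definition mutate (n : nat) (mu : seq 'I_n) (B A : 'M[int]_n) :
    'M[int]_n * 'M[int]_n :=
  foldl (@pair_mutation n) (B, A) mu.

Definition symmetric_twin (n : nat) (B A : 'M[int]_n) : Prop :=
  quasi_Cartan_companion B A /\
  forall mu : seq 'I_n,
    quasi_Cartan_companion (mutate mu B A).1 (mutate mu B A).2.

(* Main.v *)
Require Import Defs.
From mathcomp Require Import all_boot all_order all_algebra.
From mathcomp Require Import zify ring.

Set Implicit Arguments.
Unset Strict Implicit.
Unset Printing Implicit Defensive.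

Import Order.TTheory GRing.Theory Num.Theory.
Local Open Scope ring_scope.

(** Each arc [i] of the triangulation separates two triangles [t] and [u]; give
    it the vector [v_i = e_t - e_u], where the [e_t] are orthonormal vectors
    indexed by the triangles.  The companion is the Gram matrix of the [v_i].
    The sign of [v_i] is a choice, recorded as a sign on each side of each
    triangle, opposite on the two sides glued along an arc.

    - Two arcs meeting in a triangle have scalar product [1] or [-1] there.  If
      they meet in two triangles, the two contributions agree, and so do the
      two contributions to the quiver: otherwise the arcs would enclose a
      puncture.  So the Gram matrix is a quasi-Cartan companion
      ([gram_companion]).

    - A chordless cycle of the quiver either lies in one triangle, or crosses
      each of its arcs from one triangle to the next.  In the first case it is
      oriented, and each of its three arcs contributes its sign in that triangle
      twice, so that the product of the [- a] is negative.  In the second case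
      each arc contributes its two opposite signs, which compensates the minus
      sign in [- a], so that the product is positive; and the cycle is not
      oriented, since turning always in the same direction means turning around
      a puncture ([admissible_gram]).

    - Flipping the arc [k] between [t] and [u] rotates by a quarter turn the
      four sides of the quadrilateral relative to the two triangles.  With the
      signs carried along, two opposite sides of the quadrilateral exchange
      [e_t] and [e_u] while the other two do not move and [v_k] changes sign.
      Exchanging [e_t] and [e_u] is the reflection in [v_k], and the two sides
      concerned are those with an arrow to [k]: this is exactly the mutation
      of companions ([gram_flip]), while the quiver undergoes quiver mutation
      ([quiver_flip]).  So every pair obtained by mutations comes from a
      triangulation with signs ([mutate_signed]).

    The absence of punctures is used through a rank on the corners that
    decreases when one turns clockwise around a marked point.  Such a rank
    exists exactly when every fan of corners ends on the boundary, and unlike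
    the fans it is easily updated by a flip. *)

(** * Sides of triangles *)

Lemma ccw3 m (d : tside m) : ccw (ccw (ccw d)) = d.
Proof. by case: d => t [[|[|[|]]] lti] //; congr (_, _); apply: val_inj. Qed.

Lemma ccw_inj m : injective (@ccw m).
Proof. by apply: (can_inj (g := fun d => ccw (ccw d))) => d; apply: ccw3. Qed.

Lemma ccw_neq m (d : tside m) : (ccw d == d) = false.
Proof. by apply/eqP; case: d => t [[|[|[|]]] lti] // []. Qed.

Lemma ccw2_neq m (d : tside m) : (ccw (ccw d) == d) = false.
Proof. by apply/eqP; case: d => t [[|[|[|]]] lti] // []. Qed.

Lemma same_triangleP m (d e : tside m) :
  d.1 = e.1 -> [\/ e = d, e = ccw d | e = ccw (ccw d)].
Proof.
case: d e => t i [u j] /= <-{u}.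
case: i => [] [|[|[|]]] // lti; case: j => [] [|[|[|]]] // ltj;
  by first [by apply: Or31; congr (_, _); apply: val_inj
           |by apply: Or32; congr (_, _); apply: val_inj
           |by apply: Or33; congr (_, _); apply: val_inj].
Qed.

Lemma same_triangle_turn m (d e : tside m) :
  d.1 = e.1 -> d != e -> e = ccw d \/ d = ccw e.
Proof.
case/same_triangleP=> ->; first by rewrite eqxx.
  by left.
by right; rewrite ccw3.
Qed.

Lemma sum_triangle m (V : nmodType) (F : tside m -> V) (d : tside m) :
  \sum_(e | e.1 == d.1) F e = F d + F (ccw d) + F (ccw (ccw d)).
Proof.
rewrite (bigD1 d) //= (bigD1 (ccw d)) /= ?eqxx ?ccw_neq //.
rewrite (bigD1 (ccw (ccw d))) /= ?eqxx ?ccw_neq ?ccw2_neq //.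
rewrite big_pred0 ?addr0 ?addrA // => e.
apply/negP=> /andP[/andP[/andP[/eqP/esym h /eqP n1] /eqP n2] /eqP n3].
by case: (same_triangleP h).
Qed.

Lemma glued_sym m n (side : tside m -> option 'I_n) d e :
  glued side d e -> glued side e d.
Proof. by rewrite /glued eq_sym => /and3P[-> h /eqP <-]; rewrite h eqxx. Qed.

Lemma glued_unique m n (side : tside m -> option 'I_n) :
    (forall k, #|[set d | side d == Some k]| = 2%N) ->
  forall d e e', glued side d e -> glued side d e' -> e = e'.
Proof.
move=> two d e e' /and3P[nde dn /eqP h] /and3P[nde' _ /eqP h'].
case E: (side d) dn => [i|//] _; apply: contraTeq isT => nee'.
have : [set d; e; e'] \subset [set d | side d == Some i].
  apply/subsetP => x; rewrite !inE => /orP[/orP[]|] /eqP->;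
    by rewrite -?h -?h' E.
move=> /subset_leq_card; rewrite two setUC cardsU1 !inE cards2 nde.
by rewrite eq_sym (negPf nde') eq_sym (negPf nee').
Qed.

(** * Triangulations with signs *)

(** The gluing data of a triangulation, with the signs that define the vectors
    of the arcs.  The last field excludes punctures: since [d |-> ccw e],
    for [e] glued to [d], is one step of the walk around a marked point, the
    walk cannot be periodic. *)
Record signed_triangulation (n : nat) := SignedTriangulation {
  ntri : nat;
  arc_of : tside ntri -> option 'I_n;
  sgn : tside ntri -> int;
  rank : tside ntri -> nat;
  card_arc : forall k, #|[set d | arc_of d == Some k]| = 2%N;
  sgn_sqr : forall d, sgn d * sgn d = 1;
  sgn_glued : forall d e, glued arc_of d e -> sgn e = - sgn d;
  rank_glued : forall d e, glued arc_of d e -> (rank (ccw e) < rank d)%N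
}.

Arguments arc_of {n} S d : rename.
Arguments sgn {n} S d : rename.
Arguments rank {n} S d : rename.

Section Gluing.
Variables (n : nat) (S : signed_triangulation n).
Implicit Types (d e : tside (ntri S)) (i j k : 'I_n).

Definition partner_unique := glued_unique (@card_arc n S).

Lemma gluedW d e k : d != e -> arc_of S d = Some k -> arc_of S e = Some k ->
  glued (arc_of S) d e.
Proof. by rewrite /glued => -> -> ->; rewrite eqxx. Qed.

Lemma arc_sides k : exists d1 d2,
  [/\ glued (arc_of S) d1 d2, arc_of S d1 = Some k
    & forall d, (arc_of S d == Some k) = (d == d1) || (d == d2)].
Proof.
have /eqP/cards2P[d1 [d2 [ne12 E]]] := card_arc S k.
have arcE d : (arc_of S d == Some k) = (d == d1) || (d == d2).
  by have := in_set (fun d => arc_of S d == Some k) d; rewrite E !inE.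
have h1 : arc_of S d1 = Some k by apply/eqP; rewrite arcE eqxx.
have h2 : arc_of S d2 = Some k by apply/eqP; rewrite arcE eqxx orbT.
by exists d1, d2; split => //; apply: (gluedW ne12 h1 h2).
Qed.

Lemma arc_glued d1 d2 d k : glued (arc_of S) d1 d2 -> arc_of S d1 = Some k ->
  (arc_of S d == Some k) = (d == d1) || (d == d2).
Proof.
case: (arc_sides k) => e1 [e2 [_ _ E]] /and3P[ne12 _ /eqP e12] h1.
have := E d1; have := E d2; rewrite -e12 h1 eqxx E.
move=> /esym/orP[/eqP h2|/eqP h2] /esym/orP[/eqP h3|/eqP h3];
  move: ne12; rewrite h2 h3 ?eqxx // => _; by rewrite orbC.
Qed.

(** A triangle glued to itself would be self-folded: the rank would decrease
    from the corner between the two glued sides to itself. *)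
Lemma glued_triangle d e : glued (arc_of S) d e -> d.1 != e.1.
Proof.
move=> g; apply/eqP => /same_triangleP[] E; subst e.
- by move: g; rewrite /glued eqxx.
- by have := rank_glued (glued_sym g); rewrite ltnn.
- by have := rank_glued g; rewrite ccw3 ltnn.
Qed.

(** If the sides preceding and following a common point in two adjacent
    triangles were also glued, the two corners would surround a puncture. *)
Lemma no_puncture d1 d2 : glued (arc_of S) d1 d2 ->
  ~~ glued (arc_of S) (ccw d1) (ccw (ccw d2)).
Proof.
move=> g; apply/negP => g'; have := rank_glued (glued_sym g).
by have := rank_glued g'; rewrite ccw3; lia.
Qed.

Lemma arc_excl k d e : d != e -> ~~ glued (arc_of S) d e ->
  ~~ ((arc_of S d == Some k) && (arc_of S e == Some k)).
Proof.
by move=> nde; apply: contra => /andP[/eqP hd /eqP he]; apply: gluedW nde hd he.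
Qed.

Lemma arc_opp k d e :
    d != e -> (arc_of S d == Some k) && (arc_of S e == Some k) ->
  sgn S e = - sgn S d.
Proof.
by move=> nde /andP[/eqP hd /eqP he]; apply/sgn_glued/(gluedW nde hd he).
Qed.

Lemma glued_triangle_neq d1 d2 d e : glued (arc_of S) d1 d2 ->
  d.1 = d1.1 -> e.1 = d2.1 -> d != e.
Proof.
move=> g ed ee; apply: contra (glued_triangle g) => /eqP E.
by rewrite -ed -ee E.
Qed.

Lemma sgnP d : sgn S d = 1 \/ sgn S d = -1.
Proof. by have := sgn_sqr d; nia. Qed.

(** Two consecutive sides of the quadrilateral around an arc cannot carry the
    same arc; opposite sides can, which gives double arrows. *)
Lemma quad_excl d1 d2 k : glued (arc_of S) d1 d2 ->
  let is_k d := arc_of S d == Some k in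
  [/\ ~~ (is_k (ccw d1) && is_k (ccw (ccw d1))),
      ~~ (is_k (ccw d2) && is_k (ccw (ccw d2))),
      ~~ (is_k (ccw d1) && is_k (ccw (ccw d2)))
    & ~~ (is_k (ccw d2) && is_k (ccw (ccw d1)))].
Proof.
move=> g; have g' := glued_sym g.
have self d : ~~ glued (arc_of S) (ccw d) (ccw (ccw d)).
  by apply/negP => /glued_triangle; rewrite eqxx.
split; apply: arc_excl; rewrite ?self ?no_puncture // 1?eq_sym ?ccw_neq //.
  by rewrite eq_sym (glued_triangle_neq g).
by rewrite eq_sym (glued_triangle_neq g').
Qed.

(** * The Gram matrix and the quiver *)

Definition on d i : int := (arc_of S d == Some i)%:R.

(** The coordinates of the vector of the arc [i] in the orthonormal basis
    indexed by the triangles: [1] and [-1] on its two sides. *)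
Definition dual_vec i (t : 'I_(ntri S)) : int :=
  \sum_(d | d.1 == t) sgn S d * on d i.

Definition gram : 'M[int]_n :=
  \matrix_(i, j) \sum_t dual_vec i t * dual_vec j t.

Definition turns i j : int := \sum_d on d i * on (ccw d) j.

(** [quiver_of], for triangulations with signs. *)
Definition quiver : 'M[int]_n := \matrix_(i, j) (turns i j - turns j i).

Lemma gram_sym i j : gram i j = gram j i.
Proof. by rewrite !mxE; apply: eq_bigr => t _; rewrite mulrC. Qed.

Lemma quiver_anti i j : quiver i j = - quiver j i.
Proof. by rewrite !mxE opprB. Qed.

Lemma dual_vecE d i : dual_vec i d.1 =
  sgn S d * on d i + sgn S (ccw d) * on (ccw d) i
  + sgn S (ccw (ccw d)) * on (ccw (ccw d)) i.
Proof. exact: sum_triangle. Qed.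

Lemma sum_on d1 d2 k (F : tside (ntri S) -> int) :
    glued (arc_of S) d1 d2 -> arc_of S d1 = Some k ->
  \sum_d on d k * F d = F d1 + F d2.
Proof.
move=> g h; have /and3P[ne12 _ _] := g.
rewrite (bigD1 d1) //= (bigD1 d2) /= 1?eq_sym // /on !(arc_glued _ g h).
rewrite !eqxx orbT !mul1r big1 ?addr0 // => d /andP[n1 n2].
by rewrite (arc_glued _ g h) (negPf n1) (negPf n2) mul0r.
Qed.

Lemma gram_glued d1 d2 k j : glued (arc_of S) d1 d2 -> arc_of S d1 = Some k ->
  gram k j = sgn S d1 * (dual_vec j d1.1 - dual_vec j d2.1).
Proof.
move=> g h; rewrite mxE.
transitivity (\sum_d on d k * (sgn S d * dual_vec j d.1)).
  rewrite (partition_big (fun d => d.1) predT) //=; apply: eq_bigr => t _.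
  by rewrite mulr_suml; apply: eq_bigr => d /eqP ->; ring.
by rewrite (sum_on _ g h) (sgn_glued g); ring.
Qed.

Lemma quiver_glued d1 d2 k j : glued (arc_of S) d1 d2 -> arc_of S d1 = Some k ->
  quiver k j = on (ccw d1) j + on (ccw d2) j
               - on (ccw (ccw d1)) j - on (ccw (ccw d2)) j.
Proof.
move=> g h; rewrite mxE /turns (sum_on _ g h).
rewrite (reindex_inj (inj_comp (@ccw_inj _) (@ccw_inj _))) /=.
under [X in _ - X]eq_bigr => d _ do rewrite ccw3 mulrC.
by rewrite (sum_on _ g h); ring.
Qed.

(** The arcs with an arrow to [k] are those with [quiver k j < 0]; they lie on
    the sides [ccw (ccw d1)] and [ccw (ccw d2)] of the quadrilateral.  Since
    consecutive sides carry different arcs, an arc cannot occur both there and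
    on the other two sides, and when it occurs on two opposite sides its signs
    on them are opposite, like those of [k], so that nothing cancels in
    [gram k j] or in [quiver k j]. *)
Lemma gram_quiver_glued d1 d2 k j :
    glued (arc_of S) d1 d2 -> arc_of S d1 = Some k -> j != k ->
  let a := sgn S d1 * (sgn S (ccw (ccw d1)) * on (ccw (ccw d1)) j
                    - sgn S (ccw (ccw d2)) * on (ccw (ccw d2)) j) in
  `|gram k j| = `|quiver k j| /\ a = if quiver k j < 0 then gram k j else 0.
Proof.
move=> g h njk /=; rewrite (gram_glued j g h) (quiver_glued j g h) !dual_vecE.
have z d : arc_of S d == Some k -> on d j = 0.
  by rewrite /on => /eqP ->; rewrite (inj_eq Some_inj) eq_sym (negPf njk).
rewrite (z d1) ?(z d2) ?(arc_glued _ g h) ?eqxx ?orbT // !mulr0 !add0r.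
have opp d e : d.1 = d1.1 -> e.1 = d2.1 ->
    (arc_of S d == Some j) && (arc_of S e == Some j) -> sgn S e = - sgn S d.
  by move=> hd he; apply: arc_opp; apply: glued_triangle_neq g hd he.
have := opp (ccw d1) (ccw d2) erefl erefl.
have := opp (ccw (ccw d1)) (ccw (ccw d2)) erefl erefl.
case: (quad_excl j g).
(* [o1] and [o2] say that opposite sides on the same arc have opposite signs *)
rewrite /on; do 4 case: (arc_of S _ == Some j); move=> //= _ _ _ _ o1 o2;
  try rewrite (o1 isT); try rewrite (o2 isT);
  case: (sgnP d1) => ->; case: (sgnP (ccw d1)) => ->;
  try case: (sgnP (ccw d2)) => ->;
  case: (sgnP (ccw (ccw d1))) => ->; try case: (sgnP (ccw (ccw d2))) => ->;
  by split.
Qed.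

Lemma quiver_norm d1 d2 k j : glued (arc_of S) d1 d2 -> arc_of S d1 = Some k ->
  `|quiver k j| = on (ccw d1) j + on (ccw d2) j
                + (on (ccw (ccw d1)) j + on (ccw (ccw d2)) j).
Proof.
move=> g h; rewrite (quiver_glued j g h); case: (quad_excl j g).
by rewrite /on; do 4 case: (arc_of S _ == Some j).
Qed.

Lemma gram_diag i : gram i i = 2.
Proof.
have [d1 [d2 [g h E]]] := arc_sides i.
rewrite (gram_glued i g h) !dual_vecE /on !E !eqxx !ccw_neq !ccw2_neq.
have nt (x y : tside (ntri S)) : x.1 = d1.1 -> y.1 = d2.1 -> (x == y) = false.
  by move=> ex ey; apply/negbTE/(glued_triangle_neq g).
rewrite orbT !(nt (ccw d1) d2, nt (ccw (ccw d1)) d2) //.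
rewrite ![_ == d1]eq_sym !(nt d1 (ccw d2), nt d1 (ccw (ccw d2))) //=.
by rewrite (sgn_glued g); case: (sgnP d1) => ->; ring.
Qed.

Lemma gram_companion : quasi_Cartan_companion quiver gram.
Proof.
split; first by apply/matrixP => i j; rewrite mxE gram_sym.
- exact: gram_diag.
- move=> i j; rewrite eq_sym => nij; have [d1 [d2 [g h _]]] := arc_sides i.
  by have [] := gram_quiver_glued g h nij.
Qed.

(** In an unpunctured surface arrows never cancel: one turn from [i] to [j] in
    some triangle determines the signs of the entries. *)
Lemma turn_sign d i j : arc_of S d = Some i -> arc_of S (ccw d) = Some j ->
  0 < quiver i j /\ Num.sg (gram i j) = sgn S d * sgn S (ccw d).
Proof.
move=> h hj; have [d' g] : exists d', glued (arc_of S) d d'.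
  have [d1 [d2 [g h1 E]]] := arc_sides i.
  have := E d; rewrite h eqxx => /esym/orP[]/eqP->; first by exists d2.
  by exists d1; apply: glued_sym.
have self e : ~~ glued (arc_of S) e (ccw e).
  by apply/negP => /glued_triangle; rewrite eqxx.
have nji : j != i.
  apply: contra (self d) => /eqP eji; apply: (gluedW _ h); last by rewrite -eji.
  by rewrite eq_sym ccw_neq.
have z e : arc_of S e == Some i -> on e j = 0.
  by rewrite /on => /eqP ->; rewrite (inj_eq Some_inj) eq_sym (negPf nji).
rewrite (gram_glued j g h) (quiver_glued j g h) !dual_vecE.
rewrite (z d) ?(z d') ?(arc_glued _ g h) ?eqxx ?orbT // !mulr0 !add0r.
have ned : ccw d != ccw d' by apply: glued_triangle_neq g _ _.
have := arc_opp (k := j) ned.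
case: (quad_excl j g).
rewrite /on hj eqxx /= => /negPf -> _ /negPf -> _ /= o.
case: (arc_of S (ccw d') == Some j) o => /= o; rewrite ?(o isT);
  case: (sgnP d) => ->; case: (sgnP (ccw d)) => ->; by rewrite ?mulr0.
Qed.

End Gluing.

(** * Chordless cycles *)

Lemma perm_next (T : eqType) (s : seq T) : uniq s -> perm_eq (map (next s) s) s.
Proof.
move=> us; have um : uniq (map (next s) s).
  by rewrite map_inj_uniq //; apply: can_inj (prev_next us).
have sub : {subset map (next s) s <= s}.
  by move=> _ /mapP[x xs ->]; rewrite mem_next.
have le_size : (size s <= size (map (next s) s))%N by rewrite size_map.
by apply: uniq_perm => //; have [] := uniq_min_size um sub le_size.
Qed.

Lemma no_descent (T : eqType) (s : seq T) (f : T -> nat) : s != [::] ->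
  ~ (forall x, x \in s -> exists2 y, y \in s & (f y < f x)%N).
Proof.
case: s => // x0 s _ h.
have : forall N x, (f x < N)%N -> x \notin x0 :: s.
  elim=> // N IH x lt; apply/negP => /h[y ys lty].
  by have /negP[] := IH y (leq_trans lty lt).
by move=> /(_ _ x0 (ltnSn _)); rewrite mem_head.
Qed.

Section Cycles.
Variables (n : nat) (S : signed_triangulation n).
Implicit Types (d e : tside (ntri S)) (i j k : 'I_n).

Lemma quiver_gt0P i j : 0 < quiver S i j ->
  exists d, arc_of S d = Some i /\ arc_of S (ccw d) = Some j.
Proof.
move=> lt0; have nz : turns S i j != 0.
  apply: contraTneq lt0 => z; rewrite mxE z sub0r oppr_gt0 -leNgt.
  by apply: sumr_ge0 => d _; rewrite mulr_ge0 // ler0n.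
case: (pickP (fun d => (arc_of S d == Some i) && (arc_of S (ccw d) == Some j))).
  by move=> d /andP[/eqP h /eqP h']; exists d.
move=> no; case/negP: nz; apply/eqP/big1 => d _; have := no d.
by rewrite /on; case: (_ == _) => /= [->|_]; rewrite ?mulr0 ?mul0r.
Qed.

Lemma gram_sgn d e i j : arc_of S d = Some i -> arc_of S e = Some j ->
  d.1 = e.1 -> d != e -> Num.sg (gram S i j) = sgn S d * sgn S e.
Proof.
move=> hd he /same_triangleP[] E; subst e => //; rewrite ?eqxx // => _.
  by have [] := turn_sign hd he.
have h3 : arc_of S (ccw (ccw (ccw d))) = Some i by rewrite ccw3.
by rewrite gram_sym mulrC; have [_ ->] := turn_sign he h3; rewrite ccw3.
Qed.

Lemma quiver_neq0 d e i j : arc_of S d = Some i -> arc_of S e = Some j ->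
  d.1 = e.1 -> d != e -> quiver S i j != 0.
Proof.
move=> hd he /same_triangleP[] E; subst e => //; rewrite ?eqxx // => _.
  by have [/lt0r_neq0] := turn_sign hd he.
have h3 : arc_of S (ccw (ccw (ccw d))) = Some i by rewrite ccw3.
by rewrite quiver_anti oppr_eq0; have [/lt0r_neq0] := turn_sign he h3.
Qed.

(** Sides through which a cycle of the quiver crosses the triangles: from the
    side [d x] on [x] to the side [e x] on the next arc. *)
Definition crossing (s : seq 'I_n) (d e : 'I_n -> tside (ntri S)) : Prop :=
  forall x, x \in s ->
    [/\ arc_of S (d x) = Some x, arc_of S (e x) = Some (next s x),
        (d x).1 = (e x).1 & d x != e x].

Lemma chordless_crossing s : chordless_cycle (quiver S) s ->
  exists d e : 'I_n -> tside (ntri S), crossing s d e.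
Proof.
move=> [_ _ chord].
suff [f fP] : exists f : 'I_n -> tside (ntri S) * tside (ntri S),
    forall x, x \in s ->
    [/\ arc_of S (f x).1 = Some x, arc_of S (f x).2 = Some (next s x),
        (f x).1.1 = (f x).2.1 & (f x).1 != (f x).2].
  by exists (fun x => (f x).1), (fun x => (f x).2).
apply: (@fin_all_exists _ (fun=> (tside (ntri S) * tside (ntri S))%type)
  (fun x p => x \in s ->
    [/\ arc_of S p.1 = Some x, arc_of S p.2 = Some (next s x),
        p.1.1 = p.2.1 & p.1 != p.2])) => x.
have [xs|nxs] := boolP (x \in s); last first.
  by have [d _] := arc_sides S x; exists (d, d).
have adj : quiver S x (next s x) != 0 by rewrite chord ?mem_next // eqxx.
move: adj; case: ltgtP => // [|] lt _.
  have [|d [h h']] := @quiver_gt0P (next s x) x.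
    by rewrite quiver_anti oppr_gt0.
  by exists (ccw d, d) => _; split=> //; rewrite ccw_neq.
have [d [h h']] := quiver_gt0P lt.
by exists (d, ccw d) => _; split=> //; rewrite eq_sym ccw_neq.
Qed.

(** If the cycle leaves an arc through the triangle by which it reached it, the
    three arcs met there are pairwise adjacent, so that the absence of chords
    reduces the cycle to this triangle. *)
Lemma triangle_cycle s (d e : 'I_n -> tside (ntri S)) x :
    chordless_cycle (quiver S) s -> crossing s d e ->
    x \in s -> e x = d (next s x) ->
  oriented_cycle (quiver S) s /\ \prod_(y <- s) - gram S y (next s y) < 0.
Proof.
move=> [s3 us chord] de xs exE.
have dP w : w \in s -> arc_of S (d w) = Some w by case/de.
have eP w : w \in s -> arc_of S (e w) = Some (next s w) by case/de.
have tP w : w \in s -> (d w).1 = (e w).1 by case/de.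
have nP w : w \in s -> d w != e w by case/de.
have turnP w : w \in s -> e w = ccw (d w) \/ d w = ccw (e w).
  by case/de=> _ _ tri; apply: same_triangle_turn tri.
have ns w : w \in s -> next s w \in s by rewrite mem_next.
set y := next s x in exE.
have ys : y \in s := ns x xs.
case: (rot_to xs) => i [|y' [|z s']] rE.
- by move: s3; rewrite -(size_rot i) rE.
- by move: s3; rewrite -(size_rot i) rE.
have Ey : y' = y by rewrite /y -(next_rot i us) rE /= eqxx.
rewrite {y'}Ey in rE.
have perm_s : perm_eq s [:: x, y, z & s'] by rewrite -rE perm_sym perm_rot.
have nrot := next_rot i us.
have uxyz : uniq [:: x, y, z & s'] by rewrite -rE rot_uniq.
have nzx : z != x by apply: contraTneq uxyz => ->; rewrite /= !inE eqxx orbT.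
have nyx : x != y by apply: contraTneq uxyz => ->; rewrite /= !inE eqxx.
have nyz' : y != z by apply: contraTneq uxyz => ->; rewrite /= !inE eqxx andbF.
have nyz : next s y = z.
  by rewrite -nrot rE /= ?(negPf nyx) ?[y == x]eq_sym ?(negPf nyx) eqxx.
have zs : z \in s by rewrite -nyz ns.
have same : (e y).1 = (d x).1 by rewrite -(tP y) // -exE tP.
have neydx : e y != d x.
  apply: contraNneq nzx => E; have := eP y ys; rewrite E dP // nyz => -[->].
  exact: eqxx.
(* [z] and [x] meet in this triangle, so they are adjacent in the cycle *)
have nzx' : next s z = x.
  have : quiver S z x != 0.
    by apply: (@quiver_neq0 (e y) (d x)) => //; [rewrite -nyz eP|apply: dP].
  rewrite chord // => /orP[/eqP //|/eqP h].
  by have := nyz'; rewrite -h eqxx.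
have s'0 : s' = [::].
  case: s' rE uxyz {perm_s} => // w s' rE uxyz; move: nzx'; rewrite -nrot rE /=.
  rewrite [z == y]eq_sym (negPf nzx) (negPf nyz') ?(negPf nyx) ?eqxx => wx.
  by move: uxyz; rewrite wx /= !inE eqxx !orbT.
have neyex : e y != e x by rewrite exE eq_sym nP.
have adx := dP x xs; have aex : arc_of S (e x) = Some y := eP x xs.
have aey : arc_of S (e y) = Some z by rewrite -nyz eP.
rewrite s'0 in perm_s.
split.
  have neg a b : (0 < quiver S b a) = (quiver S a b < 0).
    by rewrite quiver_anti oppr_gt0.
  have turn a b p q : arc_of S p = Some a -> arc_of S q = Some b -> q = ccw p ->
      0 < quiver S a b.
    by move=> hp hq E; subst q; have [] := turn_sign hp hq.
  rewrite /oriented_cycle !(perm_all _ perm_s) /= -/y nyz nzx' !andbT.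
  apply/orP; case: (turnP x xs) => E.
    have E' : e y = ccw (e x).
      case: (same_triangleP (esym same)) => E';
        rewrite E' ?eqxx // -?E ?eqxx // in neydx neyex *.
    left; rewrite (turn _ _ _ _ adx aex E) (turn _ _ _ _ aex aey E') /=.
    by apply: (turn _ _ _ _ aey adx); rewrite E' E ccw3.
  have E' : e y = ccw (d x).
    case: (same_triangleP (esym same)) => E';
    rewrite E' ?eqxx // in neydx neyex *.
    by move: neyex; rewrite E ccw3 eqxx.
  right; rewrite -!neg (turn _ _ _ _ aex adx E).
  rewrite (turn _ _ _ _ adx aey E') andbT /=.
  by apply: (turn _ _ _ _ aey aex); rewrite E' E ccw3.
rewrite (perm_big _ perm_s) /= !big_cons big_nil -/y nyz nzx' mulr1 -sgr_lt0.
have sxy := gram_sgn adx aex (tP x xs) (nP x xs).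
have szx := gram_sgn aey adx same neydx.
have syz : Num.sg (gram S y z) = sgn S (e x) * sgn S (e y).
  by apply: (gram_sgn aex aey); [rewrite same tP|rewrite eq_sym].
rewrite !sgrM !sgrN sxy syz szx.
by case: (sgnP (d x)) => ->; case: (sgnP (e x)) => ->; case: (sgnP (e y)) => ->.
Qed.

(** If the cycle crosses all its arcs, each of them contributes its two
    opposite signs to the product of the [gram] entries, which compensates the
    minus sign.  Were the cycle oriented, its successive crossings would turn in
    the same direction around one marked point, and the rank would decrease
    forever. *)
Lemma winding_cycle s (d e : 'I_n -> tside (ntri S)) :
    chordless_cycle (quiver S) s -> crossing s d e ->
    (forall x, x \in s -> e x != d (next s x)) ->
  ~~ oriented_cycle (quiver S) s /\ 0 < \prod_(x <- s) - gram S x (next s x).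
Proof.
move=> [s3 us chord] de cross.
have nonempty : s != [::] by case: (s) s3.
have dP x : x \in s -> arc_of S (d x) = Some x by case/de.
have eP x : x \in s -> arc_of S (e x) = Some (next s x) by case/de.
have tP x : x \in s -> (d x).1 = (e x).1 by case/de.
have nP x : x \in s -> d x != e x by case/de.
have turnP x : x \in s -> e x = ccw (d x) \/ d x = ccw (e x).
  by case/de=> _ _ tri; apply: same_triangle_turn tri.
have ns x : x \in s -> next s x \in s by rewrite mem_next.
have sgP x : x \in s ->
    Num.sg (gram S x (next s x)) = sgn S (d x) * sgn S (e x).
  by move=> xs; apply: gram_sgn (dP x xs) (eP x xs) (tP x xs) (nP x xs).
have g x : x \in s -> glued (arc_of S) (e x) (d (next s x)).
  by move=> xs; apply: (gluedW (cross x xs)) (eP x xs) _; apply/dP/ns.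
split.
  apply/negP => /orP[] /allP o.
    apply: (@no_descent _ s (fun x => rank S (e x))) => // x xs.
    exists (next s x); first exact: ns.
    have := rank_glued (g x xs); have := o _ (ns x xs).
    case: (turnP _ (ns x xs)) => E; first by rewrite -E.
    have h' : arc_of S (ccw (e (next s x))) = Some (next s x).
      by rewrite -E; apply/dP/ns.
    move=> h; have [{}h' _] := turn_sign (eP _ (ns x xs)) h'.
    by move: h; rewrite quiver_anti oppr_gt0 ltNge ltW.
  apply: (@no_descent _ s (fun x => rank S (d x))) => // x' x's.
  have [x xs ->] : exists2 x, x \in s & x' = next s x.
    by exists (prev s x'); rewrite ?mem_prev ?next_prev.
  exists x => //.
  have := rank_glued (glued_sym (g x xs)); have := o _ xs.
  case: (turnP _ xs) => E; last by rewrite -E.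
  have h' : arc_of S (ccw (d x)) = Some (next s x) by rewrite -E; apply: eP.
  move=> h; have [{}h' _] := turn_sign (dP _ xs) h'.
  by move: h; rewrite ltNge ltW.
rewrite -sgr_gt0 (big_morph _ (@sgrM _) (@sgr1 _)).
have -> : \prod_(x <- s) Num.sg (- gram S x (next s x))
    = \prod_(x <- s) sgn S (d (next s x)) * \prod_(x <- s) sgn S (d x).
  rewrite -big_split /= big_seq [RHS]big_seq; apply: eq_bigr => x xs.
  by rewrite sgrN sgP // (sgn_glued (g x xs)); ring.
rewrite -(big_map (next s) predT (fun x => sgn S (d x))).
rewrite (perm_big _ (perm_next us)).
by rewrite -big_split big1 // => x _; apply: sgn_sqr.
Qed.

Lemma admissible_gram : admissible (quiver S) (gram S).
Proof.
move=> s cyc; have [d [e de]] := chordless_crossing cyc.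
have [/hasP[x xs /eqP exE]|/hasPn cross] :=
    boolP (has (fun x => e x == d (next s x)) s).
  by have [-> ?] := triangle_cycle cyc de xs exE.
by have [/negPf -> ?] := winding_cycle cyc de cross.
Qed.

End Cycles.

(** * Flips *)

(** The flip of the arc carried by [d1] and [d2], as a permutation of sides: the
    position [d] of the new triangulation receives what the old one has at
    [quad_rot d1 d2 d].  Positions are fixed, the four outer sides turn by a
    quarter turn, and exchanging [d1] and [d2] makes the vector of the
    flipped arc change sign. *)
Definition quad_rot m (d1 d2 d : tside m) : tside m :=
  if d == d1 then d2 else if d == d2 then d1
  else if d == ccw d1 then ccw (ccw d2)
  else if d == ccw (ccw d2) then ccw d2
  else if d == ccw d2 then ccw (ccw d1)
  else if d == ccw (ccw d1) then ccw d1
  else d.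

Section QuadRotation.
Variables (m : nat) (d1 d2 : tside m).
Hypothesis ne_tri : d1.1 != d2.1.

Let nt (x y : tside m) : x.1 = d1.1 -> y.1 = d2.1 -> (x == y) = false.
Proof.
by move=> ex ey; apply: contraNF ne_tri => /eqP exy; rewrite -ex -ey exy.
Qed.

Let nt' (x y : tside m) : x.1 = d1.1 -> y.1 = d2.1 -> (y == x) = false.
Proof. by rewrite eq_sym; apply: nt. Qed.

Let ccw2_neq1 (d : tside m) : (ccw (ccw d) == ccw d) = false.
Proof. exact: ccw_neq. Qed.

Let ccw1_neq2 (d : tside m) : (ccw d == ccw (ccw d)) = false.
Proof. by rewrite eq_sym ccw_neq. Qed.

Lemma quad_rotE :
  [/\ quad_rot d1 d2 d1 = d2, quad_rot d1 d2 (ccw d1) = ccw (ccw d2)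
    & quad_rot d1 d2 (ccw (ccw d1)) = ccw d1] /\
  [/\ quad_rot d1 d2 d2 = d1, quad_rot d1 d2 (ccw d2) = ccw (ccw d1)
    & quad_rot d1 d2 (ccw (ccw d2)) = ccw d2].
Proof.
have E := (ccw_neq, ccw2_neq, ccw2_neq1, ccw1_neq2, eqxx).
by split; split; rewrite /quad_rot; repeat match goal with
  | |- context [?x == ?y] =>
    rewrite ?E ?(@nt x y erefl erefl) ?(@nt' y x erefl erefl) //=
  end.
Qed.

Lemma quad_rot_out d : d.1 != d1.1 -> d.1 != d2.1 -> quad_rot d1 d2 d = d.
Proof.
move=> n1 n2; have out e : (e.1 == d1.1) || (e.1 == d2.1) -> (d == e) = false.
  by move=> h; apply/eqP => E; subst e; move: h; rewrite (negPf n1) (negPf n2).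
by rewrite /quad_rot !out //= eqxx ?orbT.
Qed.

Lemma quad_ind (P : tside m -> Prop) :
    P d1 -> P (ccw d1) -> P (ccw (ccw d1)) ->
    P d2 -> P (ccw d2) -> P (ccw (ccw d2)) ->
    (forall d, d.1 != d1.1 -> d.1 != d2.1 -> P d) ->
  forall d, P d.
Proof.
move=> h1 h2 h3 h4 h5 h6 hout d.
have [/esym/same_triangleP[]->//|n1] := eqVneq d.1 d1.1.
have [/esym/same_triangleP[]->//|n2] := eqVneq d.1 d2.1.
exact: hout.
Qed.

Lemma quad_rot_inj : injective (quad_rot d1 d2).
Proof.
have [[q1 q2 q3] [q4 q5 q6]] := quad_rotE.
pose q := quad_rot d1 d2.
(* [q] has order 4 *)
apply: (can_inj (g := fun d => q (q (q d)))) => d; rewrite /q; move: d.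
apply: quad_ind; do ?[by rewrite ?(q1, q2, q3, q4, q5, q6)].
by move=> d n1 n2; rewrite !quad_rot_out.
Qed.

Lemma sum_quad (F : tside m -> int) : \sum_d F d =
  F d1 + F (ccw d1) + F (ccw (ccw d1)) + (F d2 + F (ccw d2) + F (ccw (ccw d2)))
  + \sum_(d | (d.1 != d1.1) && (d.1 != d2.1)) F d.
Proof.
rewrite (bigID (fun d : tside m => d.1 == d1.1)) /= sum_triangle -[RHS]addrA.
congr (_ + _).
rewrite (bigID (fun d : tside m => d.1 == d2.1)) /=; congr (_ + _).
rewrite -sum_triangle; apply: eq_bigl => d.
by case: (eqVneq d.1 d2.1) => [->|]; rewrite ?andbF // eq_sym ne_tri.
Qed.

End QuadRotation.

Section Flip.
Variables (n : nat) (S : signed_triangulation n) (k : 'I_n).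
Variables (d1 d2 : tside (ntri S)).
Hypothesis g12 : glued (arc_of S) d1 d2.
Hypothesis d1k : arc_of S d1 = Some k.

Let q := quad_rot d1 d2.
Let ne_tri := glued_triangle g12.

Lemma glued_flip d e :
  glued (fun x => arc_of S (q x)) d e = glued (arc_of S) (q d) (q e).
Proof. by rewrite /glued (inj_eq (quad_rot_inj ne_tri)). Qed.

Lemma card_arc_flip i : #|[set d | arc_of S (q d) == Some i]| = 2%N.
Proof.
apply: etrans (card_arc S i).
rewrite -[RHS](card_preimset _ (quad_rot_inj ne_tri)).
by apply: eq_card => d; rewrite !inE.
Qed.

(** The flip removes the corner of [d1] from the fan of one marked point and
    inserts a corner just before the one that was at [ccw (ccw d1)], likewise
    for [d2].  Doubling the ranks makes room for the two new corners. *)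
Definition flip_rank d : nat :=
  if d == d1 then (rank S (ccw (ccw d1))).*2.+1
  else if d == d2 then (rank S (ccw (ccw d2))).*2.+1
  else (rank S (q d)).*2.

Lemma flip_rank_glued d e : glued (fun x => arc_of S (q x)) d e ->
  (flip_rank (ccw e) < flip_rank d)%N.
Proof.
have [[q1 q2 q3] [q4 q5 q6]] := quad_rotE ne_tri.
have qinj := quad_rot_inj ne_tri.
rewrite glued_flip => g.
have r12 := rank_glued g12; have r21 := rank_glued (glued_sym g12).
have nt (x y : tside (ntri S)) : x.1 = d1.1 -> y.1 = d2.1 -> (x == y) = false.
  by move=> ex ey; apply/negbTE/(glued_triangle_neq g12).
have nt' (x y : tside (ntri S)) : x.1 = d1.1 -> y.1 = d2.1 -> (y == x) = false.
  by rewrite eq_sym; apply: nt.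
have R1 : flip_rank d1 = (rank S (ccw (ccw d1))).*2.+1.
  by rewrite /flip_rank eqxx.
have R2 : flip_rank d2 = (rank S (ccw (ccw d2))).*2.+1.
  by rewrite /flip_rank nt' // eqxx.
have R x : x != d1 -> x != d2 -> flip_rank x = (rank S (q x)).*2.
  by rewrite /flip_rank => /negPf -> /negPf ->.
have Rd : e != d1 -> e != d2 -> flip_rank d = (rank S (q d)).*2.
  move=> n1 n2.
  apply: R; [apply: contra n2|apply: contra n1] => /eqP E; subst d.
    move: g; rewrite /q q1 => /(partner_unique (glued_sym g12)) h.
    by apply/eqP/qinj; rewrite q4.
  move: g; rewrite /q q4 => /(partner_unique g12) h.
  by apply/eqP/qinj; rewrite q1.
have ru := rank_glued g.
move: e g Rd ru; apply: (quad_ind (d1 := d1) (d2 := d2)).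
- rewrite /q q1 => g _ _; have E : d = d2.
    apply: qinj; rewrite q4.
    by rewrite -(partner_unique (glued_sym g12) (glued_sym g)).
  by rewrite E R2 R ?ccw_neq ?nt // /q q2 ltnS leqnn.
- rewrite /q q2 => g Rd ru; rewrite Rd ?ccw_neq ?nt // R ?ccw2_neq ?nt // /q q3.
  by move: ru; rewrite ccw3; lia.
- rewrite /q q3 => g Rd ru; rewrite Rd ?ccw2_neq ?nt // ccw3 R1.
  by move: ru; rewrite /q; lia.
- rewrite /q q4 => g _ _; have E : d = d1.
    apply: qinj; rewrite q1.
    by rewrite -(partner_unique g12 (glued_sym g)).
  by rewrite E R1 R ?ccw_neq ?nt' // /q q5 ltnS leqnn.
- rewrite /q q5 => g Rd ru; rewrite Rd ?ccw_neq ?nt' //.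
  rewrite R ?ccw2_neq ?nt' // /q q6.
  by move: ru; rewrite ccw3; lia.
- rewrite /q q6 => g Rd ru; rewrite Rd ?ccw2_neq ?nt' // ccw3 R2.
  by move: ru; rewrite /q; lia.
move=> e n1 n2 g Rd.
have out (x y : tside (ntri S)) :
    x.1 = e.1 -> (y.1 == d1.1) || (y.1 == d2.1) -> x != y.
  move=> h h'; apply/eqP => E; subst y.
  by move: h'; rewrite h (negPf n1) (negPf n2).
rewrite Rd ?R ?out ?eqxx ?orbT //= /q (quad_rot_out (d := ccw e)) //.
by rewrite (quad_rot_out (d := e)) //; lia.
Qed.

Definition flip : signed_triangulation n :=
  @SignedTriangulation n (ntri S)
    (fun d => arc_of S (q d)) (fun d => sgn S (q d)) flip_rank
    card_arc_flip (fun d => sgn_sqr (q d))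
    (fun d e g => sgn_glued (etrans (esym (glued_flip d e)) g)) flip_rank_glued.

(** The flip replaces each [v_i] by [v_i - reflection_coef i * v_k]: by its
    image under the reflection in [v_k] if there is an arrow from [i] to [k]
    or if [i = k], and by itself otherwise. *)
Definition reflection_coef i : int :=
  if i == k then 2 else if quiver S k i < 0 then gram S k i else 0.

Lemma on_k d i : i != k -> arc_of S d = Some k -> on d i = 0.
Proof.
by rewrite /on => nik ->; rewrite (inj_eq Some_inj) eq_sym (negPf nik).
Qed.

Lemma d2k : arc_of S d2 = Some k.
Proof. by have /and3P[_ _ /eqP <-] := g12. Qed.

Lemma dual_vec_k (t : 'I_(ntri S)) :
  dual_vec k t = sgn S d1 * ((t == d1.1)%:R - (t == d2.1)%:R).
Proof.
transitivity (\sum_d on d k * (sgn S d * (t == d.1)%:R)).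
  rewrite /dual_vec big_mkcond; apply: eq_bigr => d _.
  by rewrite eq_sym; case: eqP => _; rewrite ?mulr1 ?mulr0 // mulrC.
by rewrite (sum_on _ g12 d1k) (sgn_glued g12); ring.
Qed.

Lemma reflection_coefE i : i != k -> reflection_coef i =
  sgn S d1 * (sgn S (ccw (ccw d1)) * on (ccw (ccw d1)) i
              - sgn S (ccw (ccw d2)) * on (ccw (ccw d2)) i).
Proof.
move=> nik; rewrite /reflection_coef (negPf nik).
by have [_ <-] := gram_quiver_glued g12 d1k nik.
Qed.

Lemma on_same_triangle d e : arc_of S d = Some k -> e.1 = d.1 -> e != d ->
  on e k = 0.
Proof.
move=> dk ed ne; rewrite /on; case: eqP => // ek.
by have := glued_triangle (gluedW ne ek dk); rewrite ed eqxx.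
Qed.

Lemma dual_vec_flip i (t : 'I_(ntri S)) :
  dual_vec (S := flip) i t = dual_vec i t - reflection_coef i * dual_vec k t.
Proof.
have [[q1 q2 q3] [q4 q5 q6]] := quad_rotE ne_tri.
have E : dual_vec (S := flip) i t =
    \sum_(d | d.1 == t) sgn S (q d) * on (q d) i by [].
have sX x c : sgn S d1 * x * (sgn S d1 * c) = x * c.
  by rewrite mulrACA sgn_sqr mul1r.
have onk d : arc_of S d = Some k -> on (ccw d) k = 0.
  by move=> dk; apply: on_same_triangle dk _ _; rewrite ?ccw_neq.
have onk2 d : arc_of S d = Some k -> on (ccw (ccw d)) k = 0.
  by move=> dk; apply: on_same_triangle dk _ _; rewrite ?ccw2_neq.
have K : i = k -> reflection_coef i = 2.
  by rewrite /reflection_coef => ->; rewrite eqxx.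
rewrite E dual_vec_k.
have [->|n1] := eqVneq t d1.1.
  rewrite sum_triangle dual_vecE /q q1 q2 q3 (negPf ne_tri) (sgn_glued g12).
  have [ik|nik] := eqVneq i k.
    rewrite K // ik.
    rewrite ?(onk _ d1k) ?(onk _ d2k) ?(onk2 _ d1k) ?(onk2 _ d2k).
    by rewrite /on d1k d2k eqxx /=; ring.
  rewrite reflection_coefE // (on_k nik d1k) (on_k nik d2k).
  by rewrite sX subr0 mulr1; ring.
have [->|n2] := eqVneq t d2.1.
  rewrite sum_triangle dual_vecE /q q4 q5 q6 (sgn_glued g12).
  have [ik|nik] := eqVneq i k.
    rewrite K // ik.
    rewrite ?(onk _ d1k) ?(onk _ d2k) ?(onk2 _ d1k) ?(onk2 _ d2k).
    by rewrite /on d1k d2k eqxx /=; ring.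
  rewrite reflection_coefE // (on_k nik d1k) (on_k nik d2k).
  by rewrite sX sub0r mulrN1; ring.
rewrite subr0 !mulr0 subr0; apply: eq_bigr => d /eqP dt.
by rewrite /q quad_rot_out ?dt.
Qed.

(** Since [v_k] has square norm 2, the Gram matrix of the new vectors is a
    polynomial in the old entries and the coefficients, and the formula of
    companion mutation is its expression in each case of the signs of
    [quiver S i k] and [quiver S j k]. *)
Lemma gram_flip : gram flip = companion_mutation k (quiver S) (gram S).
Proof.
have [_ _ comp] := gram_companion S.
have E i j : gram flip i j = gram S i j - reflection_coef i * gram S k j
    - reflection_coef j * gram S i k
    + 2 * (reflection_coef i * reflection_coef j).
  rewrite -(gram_diag S k) ![gram S _ _]mxE !mulr_sumr -!sumrB mulr_suml.
  rewrite -big_split mxE /=.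
  by apply: eq_bigr => t _; rewrite !dual_vec_flip; ring.
have C i : i != k ->
    reflection_coef i = if 0 < quiver S i k then gram S i k else 0.
  move=> nik; rewrite /reflection_coef (negPf nik) gram_sym.
  by rewrite quiver_anti oppr_lt0.
have Ck : reflection_coef k = 2 by rewrite /reflection_coef eqxx.
have side_case i : i != k -> gram flip i k = Num.sg (quiver S i k) * gram S i k.
  move=> nik; rewrite E gram_diag Ck C //; have := comp i k nik.
  by case: (sgrP (quiver S i k)) => [h|h|h] H; lia.
apply/matrixP => i j; rewrite [RHS]mxE.
have [->|nij] := eqVneq i j; first by rewrite gram_diag.
have [jk|njk] := eqVneq j k.
  by rewrite jk side_case // -jk.
have [ik|nik] := eqVneq i k.
  by rewrite gram_sym ik side_case.
rewrite E [gram S k j]gram_sym [quiver S k j]quiver_anti !C //.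
have := comp i k nik; have := comp j k njk.
move: (quiver S i k) (quiver S j k) (gram S i k) (gram S j k) (gram S i j).
move=> b c a e x He Ha.
have opposite_signs : b * c < 0 ->
    x - a * e = x - Num.sg (a * e) * Num.max (b * - c) 0.
  move=> lt0; rewrite mulrN max_l ?oppr_ge0 ?ltW //; congr (_ - _).
  by rewrite -(ltr0_norm lt0) normrM -Ha -He -normrM -numEsg.
have same_signs : 0 <= b * c -> x = x - Num.sg (a * e) * Num.max (b * - c) 0.
  by move=> ge0; rewrite max_r ?mulr0 ?subr0 // mulrN oppr_le0.
have [b0|lb|lb] := sgrP b; have [c0|lc|lc] := sgrP c.
all: do ?[have -> : a = 0 by move: Ha; rewrite b0; lia].
all: do ?[have -> : e = 0 by move: He; rewrite c0; lia].
all: rewrite ?mul0r ?mulr0 ?sgr0 ?mul0r ?subr0 ?addr0 //.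
- by rewrite -same_signs; [ring|nia].
- by rewrite -opposite_signs; [ring|nia].
- by rewrite -opposite_signs; [ring|nia].
- by rewrite -same_signs; [ring|nia].
Qed.

Lemma quiver_flip_k j : quiver flip k j = - quiver S k j.
Proof.
have [[q1 q2 q3] [q4 q5 q6]] := quad_rotE ne_tri.
have g : glued (arc_of flip) d1 d2.
  by rewrite /= glued_flip /q q1 q4; apply: glued_sym.
have d1k' : arc_of flip d1 = Some k by rewrite /= /q q1 d2k.
rewrite (quiver_glued j g d1k') (quiver_glued j g12 d1k).
have onE d : on (S := flip) d j = on (S := S) (q d) j by [].
by rewrite !onE /q q2 q3 q5 q6; ring.
Qed.

(** Outside the quadrilateral nothing changes.  In it, let [p] and [r] count the
    occurrences of an arc on the sides reached from [k] and on the sides leading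
    to [k]; by [quiver_norm] the mutation adds [r i * p j - p i * r j], which
    removes the turns between the old neighbours and adds those between the
    new ones. *)
Lemma quiver_flip : quiver flip = quiver_mutation k (quiver S).
Proof.
apply/matrixP => i j; rewrite [RHS]mxE.
have [->|nik] := eqVneq i k; first exact: quiver_flip_k.
have [->|njk] /= := eqVneq j k.
  by rewrite quiver_anti quiver_flip_k -quiver_anti.
rewrite (quiver_anti S i k) normrN !(quiver_norm _ g12 d1k).
rewrite !(quiver_glued _ g12 d1k).
have [[q1 q2 q3] [q4 q5 q6]] := quad_rotE ne_tri.
have -> : quiver flip i j =
    \sum_d (on (S := S) (q d) i * on (S := S) (q (ccw d)) j
            - on (S := S) (q d) j * on (S := S) (q (ccw d)) i).
  by rewrite mxE /turns sumrB.
rewrite [quiver S i j]mxE /turns -sumrB !(sum_quad ne_tri) !ccw3.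
rewrite /q q1 q2 q3 q4 q5 q6.
have -> : \sum_(d | (d.1 != d1.1) && (d.1 != d2.1))
     (on (quad_rot d1 d2 d) i * on (quad_rot d1 d2 (ccw d)) j
      - on (quad_rot d1 d2 d) j * on (quad_rot d1 d2 (ccw d)) i)
   = \sum_(d | (d.1 != d1.1) && (d.1 != d2.1))
     (on d i * on (ccw d) j - on d j * on (ccw d) i).
  by apply: eq_bigr => d /andP[n1 n2]; rewrite !quad_rot_out.
rewrite !(on_k nik d1k) !(on_k nik d2k) !(on_k njk d1k) !(on_k njk d2k).
move: (\sum_(d | _) _) => X.
move: (on (ccw d1) i) (on (ccw (ccw d1)) i) => a b.
move: (on (ccw d2) i) (on (ccw (ccw d2)) i) => c e.
move: (on (ccw d1) j) (on (ccw (ccw d1)) j) => a' b'.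
move: (on (ccw d2) j) (on (ccw (ccw d2)) j) => c' e'.
rewrite (_ : _ * _ + _ * _ =
  2 * ((b + e) * (a' + c') - (a + c) * (b' + e'))); last by ring.
by rewrite mulKz //; ring.
Qed.

End Flip.

Lemma flip_mutates n (S : signed_triangulation n) k : exists S',
  quiver S' = quiver_mutation k (quiver S) /\
  gram S' = companion_mutation k (quiver S) (gram S).
Proof.
have [d1 [d2 [g h _]]] := arc_sides S k; exists (flip g).
by split; [apply: quiver_flip h|apply: gram_flip h].
Qed.

Lemma mutate_signed n (S : signed_triangulation n) mu : exists S',
  mutate mu (quiver S) (gram S) = (quiver S', gram S').
Proof.
rewrite /mutate; elim: mu S => [|k mu IH] S; first by exists S.
have [S1 [E1 E2]] := flip_mutates S k; have [S' E'] := IH S1.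
by exists S'; rewrite -E' /= /pair_mutation /= E1 E2.
Qed.

(** * Signs and ranks for a triangulation *)

Section FromTriangulation.
Variables (n : nat) (T : triangulation n).
Implicit Types d e : tside (ntriangles T).

Definition side_partner_unique := glued_unique (@arc_two_sides n T).

Definition corner_step d : tside (ntriangles T) :=
  if [pick e | glued (side T) d e] is Some e then ccw e else d.

Lemma corner_stepE d e : glued (side T) d e -> corner_step d = ccw e.
Proof.
rewrite /corner_step => g; case: pickP => [e' g'|/(_ e)]; last by rewrite g.
by rewrite (side_partner_unique g g').
Qed.

Lemma reaches_boundary d : exists N, side T (iter N corner_step d) == None.
Proof.
have [e /connectP[p]] := all_marked_points_on_boundary d.
elim: p d => [|x p IH] d /=; first by move=> _ -> h; exists 0%N; rewrite /= h.
case/andP=> /existsP[d' /andP[g /eqP ->]] pth le h.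
have [N hN] := IH _ pth le h; exists N.+1; by rewrite iterSr (corner_stepE g).
Qed.

Definition corner_rank d : nat := ex_minn (reaches_boundary d).

Lemma corner_rank_glued d e : glued (side T) d e ->
  (corner_rank (ccw e) < corner_rank d)%N.
Proof.
move=> g; rewrite /corner_rank; case: ex_minnP => N _ minN.
case: ex_minnP => [[|M]] hM _; first by case/and3P: g; rewrite hM.
by rewrite ltnS minN // -(corner_stepE g) -iterSr.
Qed.

(** Any choice of one of the two sides of each arc would do; this one is made
    with an enumeration of the sides. *)
Definition side_sign d : int :=
  if [exists e, glued (side T) d e && (enum_rank d < enum_rank e)%N]
  then 1 else -1.

Lemma side_signE d e : glued (side T) d e ->
  side_sign d = if (enum_rank d < enum_rank e)%N then 1 else -1.
Proof.
move=> g; rewrite /side_sign; congr (if _ then _ else _); apply/existsP/idP.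
  by move=> [e' /andP[/(side_partner_unique g) <-]].
by move=> h; exists e; rewrite g.
Qed.

Lemma side_sign_glued d e : glued (side T) d e -> side_sign e = - side_sign d.
Proof.
move=> g; have g' := glued_sym g.
rewrite (side_signE g) (side_signE g').
case: ltngtP => // /val_inj/enum_rank_inj E.
by move: g; rewrite /glued E eqxx.
Qed.

Lemma side_sign_sqr d : side_sign d * side_sign d = 1.
Proof. by rewrite /side_sign; case: ifP. Qed.

Definition sign_triangulation : signed_triangulation n :=
  SignedTriangulation (@arc_two_sides n T) side_sign_sqr side_sign_glued
    corner_rank_glued.

Lemma quiver_sign_triangulation : quiver sign_triangulation = quiver_of T.
Proof.
have arrowsE i j : (arrows T i j)%:Z = turns sign_triangulation i j.
  rewrite /arrows -natz -sumr_const big_mkcond; apply: eq_bigr => d _.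
  by rewrite inE /on -natrM mulnb; case: (_ && _).
by apply/matrixP => i j; rewrite !mxE !arrowsE.
Qed.

End FromTriangulation.

Theorem proposition6p2 (n : nat) (T : triangulation n) :
  exists A : 'M[int]_n,
    [/\ admissible_companion (quiver_of T) A,
        forall mu : seq 'I_n,
          admissible_companion (mutate mu (quiver_of T) A).1
                               (mutate mu (quiver_of T) A).2
      & symmetric_twin (quiver_of T) A].
Proof.
exists (gram (sign_triangulation T)); rewrite -quiver_sign_triangulation.
have main mu : admissible_companion
    (mutate mu (quiver (sign_triangulation T)) (gram (sign_triangulation T))).1
    (mutate mu (quiver (sign_triangulation T)) (gram (sign_triangulation T))).2.
  have [S' ->] := mutate_signed (sign_triangulation T) mu.
  by split; [apply: gram_companion|apply: admissible_gram].
split=> //; first exact: (main [::]).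
by split=> [|mu]; [have [] := main [::]|have [] := main mu].
Qed.
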